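(* Let $\Delta=\Delta(p)$ be a function of the prime $p$ with $\Delta(p)\to\infty$ as $p\to\infty$, and let $N$ and $S$ be any integers. Then the set $$\{xy^{-1}\pmod p:\ N+1\le x\le N+\Delta\, p^{1/2},\ S+1\le y\le S+\Delta\, p^{1/2},\ p\nmid y\}$$ (with $x,y$ integers) contains $(1+O(\Delta^{-2}))\,p$ residue classes modulo $p$.
   Context: $y^{-1}$ denotes the multiplicative inverse of $y$ modulo $p$. The statement is asymptotic as the prime $p\to\infty$ (i.e. for all sufficiently large $p$), and the constant implied by $O$ is uniform in $p$, $N$ and $S$ ($N$ and $S$ may depend on $p$). *)

(* Defs.v *)
From mathcomp Require Import all_boot all_order all_algebra.
From mathcomp Require Import all_classical all_reals all_analysis.

Set Implicit Arguments.
Unset Strict Implicit.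
Unset Printing Implicit Defensive.

Import Order.TTheory GRing.Theory Num.Theory.
Import numFieldNormedType.Exports.

Local Open Scope classical_set_scope.
Local Open Scope ring_scope.

Definition primes_oo : set_system nat := within [set p | prime p] \oo.

Global Instance primes_oo_filter : Filter primes_oo.
Proof. exact: within_filter. Qed.

(* 'F_p is Z/pZ only when p is prime.  The length L of the two intervals is
   real, so their upper ends are compared in R. *)
Definition ratio_residues (R : realType) (p : nat) (L : R) (N S : int) :
    {set 'F_p} :=
  finset (fun z : 'F_p => `[< exists x y : int,
    [/\ N + 1 <= x /\ x%:~R <= N%:~R + L,
        S + 1 <= y /\ y%:~R <= S%:~R + L,
        ~~ (p%:Z %| y)%Z
      & z = x%:~R * (y%:~R)^-1 :> 'F_p] >]).

(* Main.v *)
(** A class [z] is represented iff the lattice [{(x, y) : x = z y mod p}], of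
    determinant [p], has a point with [p] not dividing [y] in a given square of
    side [k ~ Delta sqrt p].  If it has none, its covering radius is large,
    hence it has a nonzero vector [(u, v)] of size at most [M ~ p / k], so
    [z = u / v] takes only [O(M^2) = O(p / Delta^2)] values. *)

Require Import Defs.
From mathcomp Require Import all_boot all_order all_algebra.
From mathcomp Require Import all_classical all_reals all_analysis.
From mathcomp Require Import zify ring lra.

Set Implicit Arguments.
Unset Strict Implicit.
Unset Printing Implicit Defensive.

Import Order.TTheory GRing.Theory Num.Theory.
Import numFieldNormedType.Exports.

Local Open Scope classical_set_scope.
Local Open Scope ring_scope.

(** Pigeonhole: the [Q + 1] representatives [r i] of [z * i] in [[0, p)] are sorted into [Q] classes
    by [Q * r i %/ p], and two in the same class differ by less than [p / Q]. *)
Lemma dirichlet_Fp (p Q : nat) (z : 'F_p) : prime p -> (0 < Q)%N ->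
  exists u v : int,
    [/\ 1 <= v <= Q%:Z, `|u| * Q%:Z < p%:Z & u%:~R = z * v%:~R :> 'F_p].
Proof.
move=> pr_p Q_gt0.
have p_gt0 := prime_gt0 pr_p.
pose r (i : 'I_Q.+1) : nat := z * i%:R.
have r_lt i : (r i < p)%N by rewrite -[X in (_ < X)%N](Fp_cast pr_p) ltn_ord.
have rE i : (r i)%:R = z * i%:R :> 'F_p by rewrite natr_Zp.
have g_lt i : (Q * r i %/ p < Q)%N by rewrite ltn_divLR // ltn_pmul2l.
pose g i := Ordinal (g_lt i).
have /injectivePn[i [j neq_ij g_ij]] : ~~ injectiveb g.
  apply/negP => /injectiveP /leq_card; rewrite !card_ord; lia.
wlog lt_ij : i j neq_ij g_ij / (i < j)%N.
  move=> wl; move: (neq_ij); rewrite neq_ltn => /orP[|lt_ji]; first exact: wl.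
  by apply: (wl j i) => //; rewrite eq_sym.
exists ((r j)%:Z - (r i)%:Z), (j%:Z - i%:Z); split.
- by have := ltn_ord j; lia.
- have /(congr1 val) /= := g_ij.
  have := ltn_pmod (Q * r i) p_gt0; have := ltn_pmod (Q * r j) p_gt0.
  have := divn_eq (Q * r i) p; have := divn_eq (Q * r j) p.
  by nia.
- by rewrite !intrB -!pmulrn !rE mulrBr.
Qed.

Lemma lattice_point_near (u1 v1 u2 v2 B X Y : int) :
    `|u1| <= B -> `|v1| <= B -> `|u2| <= B -> `|v2| <= B ->
    u1 * v2 != u2 * v1 ->
  exists a b : int, `|X - (a * u1 + b * u2)| <= 2 * B /\
                    `|Y - (a * v1 + b * v2)| <= 2 * B.
Proof.
move=> hu1 hv1 hu2 hv2; rewrite -subr_eq0; set D := _ - _ => D_neq0.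
(* Cramer's rule, with the coordinates rounded down. *)
set s := X * v2 - Y * u2; set t := Y * u1 - X * v1.
have D_gt0 : 0 < `|D| by rewrite normr_gt0.
exists (s %/ D)%Z, (t %/ D)%Z.
(* [c] is a coordinate of the rounding error, a combination of [w1] and [w2] whose coefficients,
   remainders divided by [D], are less than 1 in absolute value. *)
have bound (w1 w2 c : int) : `|w1| <= B -> `|w2| <= B ->
    D * c = (s %% D)%Z * w1 + (t %% D)%Z * w2 -> `|c| <= 2 * B.
  move=> hw1 hw2 Ec; rewrite -(ler_pM2l D_gt0) -normrM Ec.
  apply: le_trans (ler_normD _ _) _; rewrite !normrM.
  have -> : `|D| * (2 * B) = `|D| * B + `|D| * B by ring.
  by apply: lerD; apply: ler_pM => //; rewrite ger0_norm ?modz_ge0 // ltW // ltz_mod.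
by split; [apply: (bound u1 u2) | apply: (bound v1 v2)] => //;
   rewrite /modz /s /t; set q1 := (_ %/ _)%Z; set q2 := (_ %/ _)%Z; rewrite /D; ring.
Qed.

Lemma box_point (p M : nat) (z : 'F_p) (X Y : int) (B := (p %/ M).+1%:Z) :
    prime p -> (0 < M)%N ->
    (forall u v : int, `|u| <= M%:Z -> 1 <= v <= M%:Z ->
       u%:~R != z * v%:~R :> 'F_p) ->
  exists x y : int, [/\ `|X - x| <= 2 * B, `|Y - y| <= 2 * B
    & x%:~R = z * y%:~R :> 'F_p].
Proof.
move=> pr_p M_gt0 noshort.
(* Since [z] is no quotient of size at most [M], the vectors [(u1, v1)] and
   [(u2, v2)] satisfy [v1 <= M < |u1|] and [|u2| < M < v2], so they are
   independent. *)
have [u1 [v1 [hv1 hu1 E1]]] := dirichlet_Fp z pr_p M_gt0.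
have [u2 [v2 [hv2 hu2 E2]]] := dirichlet_Fp z pr_p (ltn0Sn (p %/ M)).
have u1_big : M%:Z < `|u1|.
  by rewrite ltNge; apply/negP => /noshort/(_ hv1)/eqP.
have lt_pB : (p < M * (p %/ M).+1)%N by rewrite mulnC ltn_ceil.
(* Here [|u2| * B < p < M * B]. *)
have u2_small : `|u2| < M%:Z by rewrite -/B in hu2; nia.
have v2_big : M%:Z < v2.
  rewrite ltNge; apply/negP => v2M; move/eqP: E2; apply/negP/noshort; first exact: ltW.
  by lia.
have u1B : `|u1| <= B by rewrite /B; nia.
have v1B : `|v1| <= B by rewrite /B in hv2 *; lia.
have u2B : `|u2| <= B by lia.
have v2B : `|v2| <= B by lia.
have indep : u1 * v2 != u2 * v1.
  (* [|u1 * v2| > M ^ 2 >= |u2 * v1|]. *)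
  by apply/eqP => /(congr1 Num.norm); rewrite !normrM; nia.
have [a [b [hx hy]]] := lattice_point_near X Y u1B v1B u2B v2B indep.
exists (a * u1 + b * u2), (a * v1 + b * v2); split => //.
by rewrite !intrD !intrM E1 E2; ring.
Qed.

Lemma ndvdz_lt (d n : int) : 0 < n < d -> ~~ (d %| n)%Z.
Proof.
move=> /andP[n_gt0 lt_nd]; apply/negP => /dvdzP[q En].
have d_gt0 := lt_trans n_gt0 lt_nd.
by move: n_gt0 lt_nd; rewrite En pmulr_lgt0 // gtr_pMl //; lia.
Qed.

Lemma mem_ratio_residues (R : realType) (p k : nat) (L : R) (N S x y : int)
    (z : 'F_p) :
    prime p -> k%:R <= L -> N + 1 <= x <= N + k%:Z -> S + 1 <= y <= S + k%:Z ->
    ~~ (p%:Z %| y)%Z -> x%:~R = z * y%:~R :> 'F_p ->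
  z \in ratio_residues p L N S.
Proof.
move=> pr_p kL /andP[x1 x2] /andP[y1 y2] ndvd Ex; rewrite inE; apply/asboolP.
have le_end (a c : int) : c <= a + k%:Z -> c%:~R <= a%:~R + L.
  by rewrite -(ler_int R) intrD => /le_trans; apply; rewrite lerD2l.
exists x, y; split; rewrite ?le_end ?x1 ?y1 //.
by rewrite Ex mulfK // -(dvdz_pcharf (pchar_Fp pr_p)).
Qed.

(** The range of [x] covers all residues, so one admissible [y] serves every [z]; since [p > 1],
    either [S + 1] or [S + 2] is prime to [p]. *)
Lemma ratio_residues_full (R : realType) (p : nat) (L : R) (N S : int) :
  prime p -> p%:R <= L -> ratio_residues p L N S = finset.setT.
Proof.
move=> pr_p pL; apply/setP => z; rewrite finset.in_setT.
have p_gt1 := prime_gt1 pr_p.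
have [y [hy ndvd]] : exists y : int, S + 1 <= y <= S + p%:Z /\ ~~ (p%:Z %| y)%Z.
  have [d1|nd] := boolP (p%:Z %| S + 1)%Z; last by exists (S + 1); split=> //; lia.
  exists (S + 2); split; first by lia.
  apply/negP => d2; have : (p%:Z %| (S + 2) - (S + 1))%Z by rewrite rpredB.
  by rewrite (_ : _ - _ = 1) ?dvdz1 /=; lia.
pose c : int := nat_of_ord (z * y%:~R).
have Ec : c%:~R = z * y%:~R :> 'F_p by rewrite /c -pmulrn natr_Zp.
pose x := N + 1 + ((c - (N + 1)) %% p%:Z)%Z.
apply: (mem_ratio_residues (x := x) (y := y) pr_p pL) => //.
  have := modz_ge0 (c - (N + 1)) (_ : p%:Z != 0).
  have := ltz_pmod (c - (N + 1)) (_ : 0 < p%:Z).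
  by rewrite /x; lia.
have -> : x = c - ((c - (N + 1)) %/ p%:Z)%Z * p%:Z by rewrite /x /modz; ring.
by rewrite intrB intrM -[p%:~R]pmulrn pchar_Fp_0 // mulr0 subr0.
Qed.

(** With [B = (p %/ M).+1], a box of radius [2 * B] spans [4 * B + 1] integers in each direction, so
    [8 * B + 2] is the height of two such boxes, one on top of the other. *)
Lemma mem_ratio_residues_noshort (R : realType) (p k M : nat) (L : R)
    (N S : int) (z : 'F_p) :
    prime p -> (0 < M)%N -> (8 * (p %/ M).+1 + 2 <= k <= p)%N -> k%:R <= L ->
    (forall u v : int, `|u| <= M%:Z -> 1 <= v <= M%:Z ->
       u%:~R != z * v%:~R :> 'F_p) ->
  z \in ratio_residues p L N S.
Proof.
move=> pr_p M_gt0 hk kL noshort.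
pose B : int := (p %/ M).+1%:Z.
(* Two boxes stacked in the [y]-direction within a height less than [p]: at
   most one of the two points has [p] dividing [y]. *)
have [x [y [hx hy E]]] :=
  box_point (N + 1 + 2 * B) (S + 1 + 2 * B) pr_p M_gt0 noshort.
have [x' [y' [hx' hy' E']]] :=
  box_point (N + 1 + 2 * B) (S + 2 + 6 * B) pr_p M_gt0 noshort.
have [dvd_y|ndvd] := boolP (p%:Z %| y)%Z; last first.
  by apply: (mem_ratio_residues (x := x) (y := y) pr_p kL) => //; lia.
have [dvd_y'|ndvd] := boolP (p%:Z %| y')%Z; last first.
  by apply: (mem_ratio_residues (x := x') (y := y') pr_p kL) => //; lia.
(* The difference is at least 1 and at most [8 * B + 1 < k <= p]. *)
suff /ndvdz_lt/negP[] : 0 < y' - y < p%:Z by exact: rpredB.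
by lia.
Qed.

Lemma card_compl_ratio_residues (R : realType) (p k M : nat) (L : R)
    (N S : int) :
    prime p -> (0 < M)%N -> (8 * (p %/ M).+1 + 2 <= k <= p)%N -> k%:R <= L ->
  (p <= #|ratio_residues p L N S| + 3 * M ^ 2)%N.
Proof.
move=> pr_p M_gt0 hk kL; set A := ratio_residues p L N S.
have cardT : (#|A| + #|~: A|)%N = p by rewrite cardsC card_Fp.
(* For [M < p] the denominators [v <= M] below are invertible mod [p]. *)
have [pM|Mp] := leqP p M; first by nia.
rewrite -[X in (X <= _)%N]cardT leq_add2l.
(* [w] encodes the pair [(u, v)] as [(u + M, v - 1)]; there are [(2 * M + 1) * M <= 3 * M ^ 2] such
   pairs. *)
pose f (w : 'I_(2 * M).+1 * 'I_M) : 'F_p :=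
  (w.1%:Z - M%:Z)%:~R / w.2.+1%:R.
have sub : ~: A \subset f @: finset.setT.
  apply/fintype.subsetP => z; rewrite finset.in_setC; apply: contraR => zf.
  apply: (mem_ratio_residues_noshort N S pr_p M_gt0 hk kL) => u v hu hv.
  apply: contra zf => /eqP Ez.
  have u_lt : (absz (u + M%:Z)%R < (2 * M).+1)%N by lia.
  have v_lt : ((absz v).-1 < M)%N by lia.
  apply/imsetP; exists (Ordinal u_lt, Ordinal v_lt); rewrite ?inE // /f /=.
  have -> : (absz (u + M%:Z)%R)%:Z - M%:Z = u by lia.
  have -> : (absz v).-1.+1%:R = v%:~R :> 'F_p.
    by rewrite pmulrn; congr (_%:~R); lia.
  rewrite Ez mulfK // -(dvdz_pcharf (pchar_Fp pr_p)).
  by apply: ndvdz_lt; lia.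
apply: leq_trans (subset_leq_card sub) _.
apply: leq_trans (leq_imset_card _ _) _.
by rewrite cardsT card_prod !card_ord; nia.
Qed.

Lemma card_ratio_residues_ge (R : realType) (p : nat) (L : R) (N S : int) :
    prime p -> 21 <= L ->
  p%:R - #|ratio_residues p L N S|%:R <= 3 * (34 * (p%:R / L)) ^+ 2.
Proof.
move=> pr_p L21.
have L_gt0 : 0 < L by lra.
have [pL|Lp] := lerP p%:R L.
  rewrite ratio_residues_full // cardsT card_Fp // subrr.
  by rewrite mulr_ge0 ?sqr_ge0.
have /andP[kL Lk] := truncn_itv (ltW L_gt0).
set k := Num.truncn L in kL Lk.
have k20 : (20 <= k)%N.
  by rewrite -ltnS -(ltr_nat R); apply: le_lt_trans Lk; apply: le_trans L21; lra.
have kp : (k < p)%N by rewrite -(ltr_nat R); exact: le_lt_trans Lp.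
(* This gives [16 * p < M * k], so [q = p %/ M] satisfies [8 * q < k / 2], and
   [8 * (q + 1) + 2 <= k] follows from [k >= 20]. *)
pose M := (16 * p %/ k).+1.
have Mk : (M * k <= 17 * p)%N.
  have := leq_divM (16 * p) k; rewrite /M; lia.
have hk : (8 * (p %/ M).+1 + 2 <= k <= p)%N.
  have := leq_divM p M.
  have : (16 * p < M * k)%N by rewrite ltn_ceil //; lia.
  set q := (p %/ M)%N => h1 h2.
  have : (16 * q < k)%N by nia.
  lia.
have := card_compl_ratio_residues N S pr_p (ltn0Sn _ : (0 < M)%N) hk kL.
rewrite -(ler_nat R) natrD natrM natrX => card_le.
apply: (@le_trans _ _ (3 * M%:R ^+ 2)); first by lra.
(* 34 is twice 17: [L <= 2 * k] and [M * k <= 17 * p]. *)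
have ML : M%:R <= 34 * (p%:R / L).
  rewrite mulrA ler_pdivlMr //.
  move: Mk; rewrite -(ler_nat R) !natrM => Mk.
  have : L <= 2 * k%:R.
    by move: Lk k20; rewrite -natr1 -(ler_nat R); lra.
  have M_ge0 : 0 <= M%:R :> R by [].
  by move=> /(ler_wpM2l M_ge0); lra.
by rewrite ler_pM2l // lerXn2r // nnegrE // (le_trans _ ML).
Qed.

Theorem theorem8 (R : realType) (Delta : nat -> R)
    (hDelta : Delta p @[p --> primes_oo] --> +oo) :
  exists2 C : R, 0 < C &
    \forall p \near primes_oo, forall N S : int,
      exists2 e : R, `|e| <= C * (Delta p) ^- 2 &
        #|ratio_residues p (Delta p * Num.sqrt p%:R) N S|%:R
          = (1 + e) * p%:R :> R.
Proof.
exists (3 * 34 ^+ 2); first by rewrite mulr_gt0 ?exprn_gt0.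
have pr_near : \forall p \near primes_oo, prime p by exists 0%N.
have D_near : \forall p \near primes_oo, 21 <= Delta p.
  by move/cvgryPge: hDelta; apply.
apply: filterS2 pr_near D_near => p pr_p D21 N S.
have p_gt0 : 0 < p%:R :> R by rewrite ltr0n prime_gt0.
have D_gt0 : 0 < Delta p by lra.
have sq_ge1 : 1 <= Num.sqrt p%:R :> R.
  by rewrite -[leLHS]sqrtr1 ler_sqrt // ler1n prime_gt0.
set L := Delta p * _.
have L21 : 21 <= L by rewrite /L; nra.
set A := ratio_residues p L N S.
exists (#|A|%:R / p%:R - 1); last by rewrite addrC subrK divfK ?gt_eqF.
have A_le : #|A|%:R <= p%:R :> R by rewrite ler_nat (leq_trans (max_card _)) ?card_Fp.
rewrite ler0_norm ?subr_le0 ?ler_pdivrMr ?mul1r // opprB.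
rewrite -(ler_pM2r p_gt0) mulrBl mul1r divfK ?gt_eqF //.
apply: le_trans (card_ratio_residues_ge N S pr_p L21) _.
(* For [L = Delta p * sqrt p] one has [(p / L) ^ 2 = p / Delta p ^ 2], so both sides agree. *)
rewrite /L exprMn expr_div_n exprMn sqr_sqrtr ?ler0n // le_eqVlt; apply/orP; left.
by apply/eqP; field; rewrite !gt_eqF.
Qed.
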